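(* Let $G$ be a finite powerful $2$-group. Then, for every integer $i\ge 0$: (i) $\exp[\Omega_i(G),G]\le 2^i$. (ii) $\exp\Omega_i(G)\le 2^{i+1}$.
   Context: For a group $G$ and $n\ge 1$, $G^n$ denotes the subgroup generated by all $n$-th powers of elements of $G$. A finite $2$-group $G$ is powerful if $[G,G]\le G^4$. For $i\ge 0$, $\Omega_i(G)$ is the subgroup of $G$ generated by all elements of $G$ of order at most $2^i$. For a subgroup $A\le G$, $[A,G]$ is the subgroup generated by all commutators $[a,g]=a^{-1}g^{-1}ag$ with $a\in A$, $g\in G$. $\exp$ denotes the exponent of a finite group. *)

(* Defs.v *)
From mathcomp Require Import all_boot all_fingroup all_solvable.

Set Implicit Arguments.
Unset Strict Implicit.
Unset Printing Implicit Defensive.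

Import GroupScope.

Definition power_subgroup (gT : finGroupType) (n : nat) (G : {set gT}) :
    {set gT} :=
  <<[set x ^+ n | x in G]>>.

(* The definition of "powerful" for a finite 2-group: the general condition
   [G, G] <= G^p, for odd p, is replaced by [G, G] <= G^4 when p = 2. *)
Definition powerful2 (gT : finGroupType) (G : {set gT}) : bool :=
  [~: G, G] \subset power_subgroup 4 G.

(* On 2-groups the library's 'Ohm_i(G) is generated by the elements of order
   at most 2 ^ i. *)
Lemma Ohm_2group_order (gT : finGroupType) (G : {group gT}) (i : nat) :
  2.-group G -> 'Ohm_i(G) = <<[set x in G | #[x] <= 2 ^ i]>>.
Proof.
move=> pG; rewrite (OhmE i pG); congr <<_>>; apply/setP=> x.
rewrite !inE; case Gx: (x \in G) => //=.
have /p_natP[k ox] := mem_p_elt pG Gx.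
by rewrite -order_dvdn ox dvdn_Pexp2l // leq_exp2l.
Qed.

(* Main.v *)
Require Import Defs.
From mathcomp Require Import all_boot all_fingroup all_solvable.

Set Implicit Arguments.
Unset Strict Implicit.
Unset Printing Implicit Defensive.

Import GroupScope.

(** Write P_k for 'Mho^k(G), the subgroup generated by the 2^k-th powers, and
    E_i for the set of x in G with x^(2^i) = 1.

    The heart of the matter is that E_i behaves regularly with respect to P_1:
    for x in E_i and y in P_1, x y lies in E_i if and only if y does
    (powerful_torsion_regular). Granting this, T = E_i meet P_1 is a normal
    subgroup of exponent at most 2^i. If x is in E_i and u is in G, the subgroup
    H = <x> P_1 is again powerful and contains x and x^u = x [x, u], with
    [x, u] in P_2, which lies in 'Mho^1(H); regularity in H gives [x, u] in E_i.
    So Omega_i(G) is central in G modulo T, which is (i). Its generators square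
    into T, so Omega_i(G) / T is elementary abelian, which gives (ii).

    Regularity is proved by induction on |G|. For proper powerful subgroups it
    yields two facts about G: E_i is closed under commutation with G (by the
    argument above in H, unless G is cyclic), and E_i meet P_2 is closed
    under products (P_1 is powerful and its squares generate P_2). From them
    follows the delicate estimate comm_exp_torsion: if u is in E_(s+1) and x in
    E_s, then [u^(2^k), x] is in E_(s-k), a gain of one over what the order of
    u^(2^k) alone gives. It implies that [y, x] is in E_(i-1) when x is in E_i
    and y in E_i meet P_1, so (x y)^2 = x^2 y^2 [y, x]^y has the same shape as
    x y with i - 1 in place of i, and x y is in E_i (torsionM). The converse
    comes from successive approximation along the filtration P_k: an element y
    whose 2^i-th power lies in P_m can be corrected by an element h of P_(m-i)
    to lie in E_i, and (x y)^(2^i) = 1 then forces h^(2^i), hence y^(2^i), into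
    P_(m+1).

    All this rests on the classical theory of powerful 2-groups:
    [P_k, G] <= P_(k+2), every element of P_(k+j) is a 2^j-th power of an
    element of P_k, and (g h)^(2^i) = g^(2^i) h^(2^i) modulo P_(k+i+1) for h in
    P_k. *)

(** * Squares of powerfully embedded subgroups *)

Implicit Type gT : finGroupType.

Lemma mem_Mho gT (G : {group gT}) k x :
  2.-group G -> x \in G -> x ^+ (2 ^ k) \in 'Mho^k(G).
Proof. by move=> pG Gx; rewrite (Mho_p_elt _ Gx) // (mem_p_elt pG). Qed.

Lemma Mho2_sub_Mho1_Mho1 gT (N : {group gT}) :
  2.-group N -> 'Mho^2(N) \subset 'Mho^1('Mho^1(N)).
Proof.
move=> pN; have pM := pgroupS (Mho_sub 1 N) pN.
rewrite (MhoE 2 pN) gen_subG; apply/subsetP=> _ /imsetP[x Nx ->].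
by rewrite (expgM x 2 2) (mem_Mho 1 pM) // (mem_Mho 1 pN).
Qed.

Lemma quotient_Mho gT k (H Q : {group gT}) :
  H \subset 'N(Q) -> 'Mho^k(H) / Q = 'Mho^k(H / Q).
Proof. exact: morphim_Mho. Qed.

(** To prove K <= Q it is enough to work modulo [K, G]: in the nilpotent group
    G / Q, a nontrivial normal subgroup is never equal to its commutator with
    the whole group. *)
Lemma sub_nilpotent_join_comm gT (G K Q : {group gT}) :
    nilpotent G -> K \subset G -> G \subset 'N(K) -> Q <| G ->
  K \subset Q <*> [~: K, G] -> K \subset Q.
Proof.
move=> nilG sKG nKG /andP[sQG nQG] sK.
have nQK := subset_trans sKG nQG.
have nQR : [~: K, G] \subset 'N(Q).
  by rewrite (subset_trans _ nQG) // commg_subr ?(subset_trans sKG) ?normG.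
rewrite -quotient_sub1 //; apply/trivgP/eqP; apply: contraT => ntK.
have: K / Q \subset [~: K / Q, G / Q].
  by rewrite -quotientR // -(quotientYidl nQR) quotientS.
rewrite -(negbK (_ \subset _)) => /negP[].
apply: proper_subn; apply: (nil_comm_properl (quotient_nil Q nilG)) => //.
  exact: quotientS.
by rewrite subsetI subxx quotient_norms.
Qed.

(** Write M for the subgroup generated by the squares of N. As [M, G] is central,
    squaring passes through commutators [m, g] with m in M, and with 'Mho^2(M)
    trivial this makes 'Mho^1(M) elementary abelian. Since [N, G] lies in
    'Mho^1(M), fourth powers of N and then squares of N are central. *)
Lemma Mho1_central gT (G N : {group gT}) :
    2.-group G -> N <| G -> [~: N, G] \subset 'Mho^2(N) ->
    'Mho^2('Mho^1(N)) = 1 -> [~: 'Mho^1(N), G] \subset 'C(G) ->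
  'Mho^1(N) \subset 'C(G).
Proof.
move=> pG /andP[sNG nNG] sRN M4 cR.
have pN := pgroupS sNG pG; have sMN := Mho_sub 1 N.
have pM := pgroupS sMN pN; set M := 'Mho^1(N)%G.
have sMG : M \subset G := subset_trans sMN sNG.
have comm_sq m g : m \in M -> g \in G -> [~ m ^+ 2, g] = [~ m, g] ^+ 2.
  move=> Mm Gg; apply: commXg; apply/commute_sym.
  by apply: (centP (subsetP cR _ (mem_commg Mm Gg))); apply: (subsetP sMG).
have sq1 u : u \in 'Mho^1(M) -> u ^+ 2 = 1.
  (* The commutator of a^2 and b^2 is [a, b]^4, an element of 'Mho^2(M) = 1. *)
  have cMM : abelian 'Mho^1(M).
    rewrite (MhoE 1 pM) abelian_gen; apply/centsP=> _ /imsetP[a Ma ->].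
    move=> _ /imsetP[b Mb ->]; apply/commgP.
    have [Ga Gb] := (subsetP sMG a Ma, subsetP sMG b Mb).
    have Ra : [~ a, b ^+ 2] = [~ a, b] ^+ 2.
      rewrite -invg_comm comm_sq // -expgVn invg_comm //.
    rewrite comm_sq ?groupX // Ra -expgM; apply/eqP/set1gP; rewrite -M4.
    by apply: (mem_Mho 2 pM); rewrite groupR.
  move=> Mu; apply: exponentP u Mu; move: cMM; rewrite (MhoE 1 pM) abelian_gen => cMM.
  rewrite (abelian_exponent_gen cMM).
  apply/exponentP=> _ /imsetP[a Ma ->].
  by apply/set1gP; rewrite -expgM -M4 (mem_Mho 2 pM).
have sN2 := subset_trans sRN (Mho2_sub_Mho1_Mho1 pN).
have cN4 : 'Mho^2(N) \subset 'C(G).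
  rewrite (MhoE 2 pN) gen_subG; apply/subsetP=> _ /imsetP[n Nn ->].
  apply/centP=> g Gg; apply/commgP; rewrite (expgM n 2 2).
  rewrite comm_sq ?(mem_Mho 1 pN) //; apply/eqP/sq1/(subsetP sN2).
  by rewrite mem_commg ?groupX.
rewrite (MhoE 1 pN) gen_subG; apply/subsetP=> _ /imsetP[n Nn ->].
apply/centP=> g Gg; apply/commgP.
have Rn := mem_commg Nn Gg; rewrite commXg.
  by apply/eqP/sq1/(subsetP sN2).
apply/commute_sym/(centP (subsetP cN4 _ (subsetP sRN _ Rn))).
exact: (subsetP sNG).
Qed.

(** The property [N, G] <= 'Mho^2(N) of being powerfully embedded passes from N to
    M = 'Mho^1(N). By nilpotency it may be checked modulo
    'Mho^2(M) [M, G, G], where Mho1_central applies. *)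
Lemma Mho1_comm_sub gT (G N : {group gT}) :
    2.-group G -> N <| G -> [~: N, G] \subset 'Mho^2(N) ->
  [~: 'Mho^1(N), G] \subset 'Mho^2('Mho^1(N)).
Proof.
move=> pG nsNG sRN; have [sNG nNG] := andP nsNG.
have sMG : 'Mho^1(N) \subset G := subset_trans (Mho_sub 1 N) sNG.
have nsMG : 'Mho^1(N) <| G := gFnormal_trans _ nsNG.
have nsM4 : 'Mho^2('Mho^1(N)) <| G := gFnormal_trans _ nsMG.
have nMG := normal_norm nsMG.
have sKG : [~: 'Mho^1(N), G] \subset G by rewrite commg_subr (subset_trans sMG) ?normG.
apply: (@sub_nilpotent_join_comm _ G) => //.
- exact: pgroup_nil pG.
- by rewrite normsR ?normG.
set Q := _ <*> _.
have nsQ : Q <| G.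
  rewrite normalY // /normal commg_subr (subset_trans sKG) ?normG //=.
  by rewrite !normsR ?normG.
have [sQG nQG] := andP nsQ.
have nQN := subset_trans sNG nQG.
rewrite -quotient_cents2 ?(subset_trans sMG) //.
have MQ k (H : {group gT}) : H \subset G -> 'Mho^k(H) / Q = 'Mho^k(H / Q).
  by move=> sHG; rewrite quotient_Mho ?(subset_trans sHG).
rewrite MQ //.
apply: Mho1_central.
- exact: quotient_pgroup.
- exact: quotient_normal.
- by rewrite -quotientR // -MQ // quotientS.
- rewrite -!MQ //; apply/trivgP; rewrite quotient_sub1 ?joing_subl //.
  exact: subset_trans (normal_sub nsM4) nQG.
rewrite -MQ // -quotientR ?(subset_trans sMG) //.
by rewrite quotient_cents2 ?joing_subr ?(subset_trans sKG).
Qed.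

(** * The power filtration of a powerful 2-group *)

Lemma expMg2 gT (y c : gT) : (y * c) ^+ 2 = y ^+ 2 * c ^+ 2 * [~ c, y] ^ c.
Proof.
rewrite /commg /conjg !(expgS _ 1) !expg1 !mulgA.
by rewrite !mulgK.
Qed.

Lemma comm_sqrg gT (v x : gT) :
  [~ v ^+ 2, x] = [~ v, x] ^+ 2 * [~ [~ v, x], v] ^ [~ v, x].
Proof.
rewrite [v ^+ 2]expgS expg1 commMgJ conjg_mulR.
move: [~ v, x] => f; move: [~ f, v] => e.
by rewrite conjgE expgS expg1 !mulgA mulgK.
Qed.

(** The filtration is built by iterated squaring, along which Mho1_comm_sub
    propagates; sq_iterE identifies it with the subgroups 'Mho^k(G). *)
Definition sq_iter gT (G : {group gT}) k : {group gT} :=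
  iter k (fun H : {group gT} => 'Mho^1(H)%G) G.

Lemma sq_iterS gT (G : {group gT}) k : sq_iter G k.+1 = 'Mho^1(sq_iter G k)%G.
Proof. by []. Qed.

Section PowerfulFiltration.

Variables (gT : finGroupType) (G : {group gT}).
Hypotheses (pG : 2.-group G) (powG : [~: G, G] \subset 'Mho^2(G)).

Lemma sq_iter_normal k : sq_iter G k <| G.
Proof.
by elim: k => [|k IHk]; [exact: normal_refl | rewrite sq_iterS gFnormal_trans].
Qed.

Lemma sq_iter_pgroup k : 2.-group (sq_iter G k).
Proof. exact: pgroupS (normal_sub (sq_iter_normal k)) pG. Qed.

Lemma sq_iter_sub j k : j <= k -> sq_iter G k \subset sq_iter G j.
Proof.
move=> /subnK <-; elim: (k - j) => // n; apply: subset_trans.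
by rewrite addSn sq_iterS Mho_sub.
Qed.

Lemma sq_iter_comm k : [~: sq_iter G k, G] \subset sq_iter G k.+2.
Proof.
apply: subset_trans (Mho2_sub_Mho1_Mho1 (sq_iter_pgroup k)).
elim: k => // k IHk; rewrite sq_iterS.
exact: Mho1_comm_sub (sq_iter_normal k) IHk.
Qed.

Lemma sq_iter_eventually1 : exists n, sq_iter G n = 1%G.
Proof.
have card_sq k : #|sq_iter G k| <= maxn 1 (#|G| - k).
  elim: k => [|k IHk]; first by rewrite subn0 leq_max leqnn orbT.
  rewrite sq_iterS; set N := sq_iter G k in IHk *.
  have [-> | ntN] := eqVneq N 1%G; first by rewrite /= Mho1 cards1 leq_maxl.
  have: 'Mho^1(N) \proper N.
    apply: sub_proper_trans (Phi_proper ntN).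
    by rewrite (Phi_joing (sq_iter_pgroup k)) joing_subr.
  move/proper_card=> ltMN; have := leq_trans ltMN IHk.
  rewrite !leq_max subnS => /orP[/ltnW-> // | ltMk].
  by apply/orP; right; rewrite -ltnS prednK // (leq_ltn_trans _ ltMk).
exists #|G|; apply/val_inj/card_le1_trivg.
by have:= card_sq #|G|; rewrite subnn.
Qed.

(** The factor of two consecutive terms is generated by squares, and modulo the
    term after them the group is abelian, so squaring is a homomorphism there. *)
Lemma sq_iter_root_mod k x : x \in sq_iter G k.+1 ->
  exists2 y, y \in sq_iter G k & (y ^+ 2)^-1 * x \in sq_iter G k.+2.
Proof.
have nS := normal_norm (sq_iter_normal k.+2).
have nN := subset_trans (normal_sub (sq_iter_normal k)) nS.
rewrite sq_iterS => Mx; have Nx := subsetP (Mho_sub 1 _) _ Mx.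
have: coset (sq_iter G k.+2) x \in 'Mho^1(sq_iter G k / sq_iter G k.+2).
  by rewrite -quotient_Mho ?mem_quotient.
rewrite (MhoEabelian 1 (quotient_pgroup _ (sq_iter_pgroup k))); last first.
  rewrite /abelian quotient_cents2 // (subset_trans _ (sq_iter_comm k)) //.
  by rewrite commgS ?normal_sub ?sq_iter_normal.
case/imsetP=> _ /morphimP[y Ny Ky ->]; rewrite -morphX //= => exy.
exists y => //; apply: coset_idr.
  by rewrite groupM ?groupV ?groupX // (subsetP nN).
by rewrite morphM ?morphV ?groupV ?groupX ?(subsetP nN) //= exy mulVg.
Qed.

(** An approximate square root is refined one term of the filtration at a time,
    the error of (y c)^2 against y^2 c^2 being [c, y]^c, two terms deeper than c;
    the filtration ends at 1, so the root becomes exact. *)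
Lemma sq_iter_root1 k x : x \in sq_iter G k.+1 ->
  exists2 y, y \in sq_iter G k & x = y ^+ 2.
Proof.
move=> Mx; have root_mod j :
    exists2 y, y \in sq_iter G k & (y ^+ 2)^-1 * x \in sq_iter G (j + k.+1).
  elim: j => [|j [y Ny]]; first by exists 1; rewrite ?group1 // expg1n invg1 mul1g.
  rewrite addnS => /sq_iter_root_mod[c Nc Sc].
  exists (y * c); first by rewrite groupM // (subsetP (sq_iter_sub (leq_addl j k))).
  have Gy := subsetP (normal_sub (sq_iter_normal _)) _ Ny.
  have Gc := subsetP (normal_sub (sq_iter_normal _)) _ Nc.
  have -> : ((y * c) ^+ 2)^-1 * x =
     ([~ c, y] ^ c)^-1 * ((c ^+ 2)^-1 * ((y ^+ 2)^-1 * x)).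
    by rewrite expMg2 !invMg !mulgA.
  rewrite !addSn !addnS in Sc *.
  rewrite groupM // groupV memJ_norm.
    by rewrite (subsetP (sq_iter_comm _)) // mem_commg.
  by rewrite (subsetP (normal_norm (sq_iter_normal _))).
have [n sq1] := sq_iter_eventually1; have [y Ny] := root_mod n.
move/(subsetP (sq_iter_sub (leq_addr _ _))); rewrite sq1 => /set1P/eqP.
by rewrite -eq_mulVg1 => /eqP <-; exists y.
Qed.

Lemma sq_iter_root k j x : x \in sq_iter G (k + j) ->
  exists2 y, y \in sq_iter G k & x = y ^+ (2 ^ j).
Proof.
elim: j x => [|j IHj] x; first by rewrite addn0; exists x.
rewrite addnS => /sq_iter_root1[_ /IHj[y Ny ->] ->].
by exists y; rewrite // -expgM -expnSr.
Qed.

Lemma sq_iter_exp k j x : x \in sq_iter G k -> x ^+ (2 ^ j) \in sq_iter G (k + j).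
Proof.
move=> Nx; elim: j => [|j IHj]; rewrite ?addn0 // addnS sq_iterS expnSr expgM.
exact: (mem_Mho 1 (sq_iter_pgroup _) IHj).
Qed.

Lemma Mho_sq_iter j k : 'Mho^j(sq_iter G k) = sq_iter G (k + j).
Proof.
apply/eqP; rewrite eqEsubset {1}(MhoE j (sq_iter_pgroup k)) gen_subG.
apply/andP; split; apply/subsetP=> x.
  by case/imsetP=> y Ny ->; apply: sq_iter_exp.
by case/sq_iter_root=> y Ny ->; apply: mem_Mho Ny; apply: sq_iter_pgroup.
Qed.

Lemma sq_iterE k : 'Mho^k(G) = sq_iter G k.
Proof. exact: Mho_sq_iter k 0. Qed.

Lemma Mho_Mho j k : 'Mho^j('Mho^k(G)) = 'Mho^(k + j)(G).
Proof. by rewrite !sq_iterE Mho_sq_iter. Qed.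

Lemma Mho_comm k : [~: 'Mho^k(G), G] \subset 'Mho^k.+2(G).
Proof. by rewrite !sq_iterE sq_iter_comm. Qed.

Lemma Mho_root k j x : x \in 'Mho^(k + j)(G) ->
  exists2 y, y \in 'Mho^k(G) & x = y ^+ (2 ^ j).
Proof. by rewrite !sq_iterE; apply: sq_iter_root. Qed.

Lemma Mho_exp k j x : x \in 'Mho^k(G) -> x ^+ (2 ^ j) \in 'Mho^(k + j)(G).
Proof. by rewrite !sq_iterE; apply: sq_iter_exp. Qed.

Lemma Mho_eventually1 : exists n, 'Mho^n(G) = 1.
Proof. by have [n sq1] := sq_iter_eventually1; exists n; rewrite sq_iterE sq1. Qed.

Lemma mem_Mho_comm k x y :
  x \in 'Mho^k(G) -> y \in G -> [~ x, y] \in 'Mho^k.+2(G).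
Proof. by move=> Mx Gy; rewrite (subsetP (Mho_comm k)) ?mem_commg. Qed.

Lemma MhoJ_mem k x y : y \in G -> (x ^ y \in 'Mho^k(G)) = (x \in 'Mho^k(G)).
Proof. by move=> Gy; rewrite memJ_norm // (subsetP (gFnorm _ _)). Qed.

(** By induction on i: (g h)^2 = g^2 (h^2 d) with d in P_(k+2) and h^2 d in
    P_(k+1), so both the product of g^2 with h^2 d and that of h^2 with d fall
    under the statement for i - 1. *)
Lemma expMg_mod i k g h : g \in G -> h \in 'Mho^k(G) ->
  exists2 r, r \in 'Mho^(k + i).+1(G) &
    (g * h) ^+ (2 ^ i) = g ^+ (2 ^ i) * h ^+ (2 ^ i) * r.
Proof.
elim: i k g h => [|i IHi] k g h Gg Mh.
  by exists 1; rewrite ?group1 ?mulg1.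
have Gh := subsetP (Mho_sub _ _) _ Mh.
set d := [~ h, g] ^ h.
have Md : d \in 'Mho^k.+2(G) by rewrite MhoJ_mem // mem_Mho_comm.
have Mh2 : h ^+ 2 \in 'Mho^k.+1(G) by rewrite -[k.+1]addn1 (Mho_exp 1).
have Mh2d : h ^+ 2 * d \in 'Mho^k.+1(G).
  by rewrite groupM // (subsetP (Mho_leq _ (leqnSn _))).
rewrite !expnS !expgM expMg2 -/d -mulgA.
have [r1 Mr1 ->] := IHi _ _ _ (groupX 2 Gg) Mh2d.
have [r2 Mr2 ->] := IHi _ _ _ (groupX 2 Gh) Md.
exists (d ^+ (2 ^ i) * r2 * r1); last by rewrite !mulgA.
rewrite addnS; rewrite addSn in Mr1; rewrite !groupM //.
  by rewrite -!addSn Mho_exp.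
by apply: subsetP _ _ Mr2; apply: Mho_leq; rewrite !addSn.
Qed.

End PowerfulFiltration.

(** * Regularity of the torsion of a powerful 2-group *)

Lemma expg2_eq1_leq gT (x : gT) i j :
  i <= j -> x ^+ (2 ^ i) = 1 -> x ^+ (2 ^ j) = 1.
Proof. by move=> /subnKC <- xi; rewrite expnD expgM xi expg1n. Qed.

(** The restriction of y to 'Mho^1(G) is essential: two involutions of a powerful
    2-group can have a product of order 4. The implication from x y to y serves
    to bound commutators, through x^u = x [x, u]. *)
Definition torsion_regular gT (G : {set gT}) :=
  forall i x y, x \in G -> y \in 'Mho^1(G) -> x ^+ (2 ^ i) = 1 ->
    (x * y) ^+ (2 ^ i) = 1 <-> y ^+ (2 ^ i) = 1.

Section TorsionStep.

Variables (gT : finGroupType) (G : {group gT}).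
Hypotheses (pG : 2.-group G) (powG : [~: G, G] \subset 'Mho^2(G)).

Lemma Mho1_properVtriv : 'Mho^1(G) \proper G \/ G :=: 1.
Proof.
have [-> | ntG] := eqVneq G 1%G; first by right.
left; apply: sub_proper_trans (Phi_proper ntG).
by rewrite (Phi_joing pG) joing_subr.
Qed.

Lemma powerful_Mho1 : [~: 'Mho^1(G), 'Mho^1(G)] \subset 'Mho^2('Mho^1(G)).
Proof.
by rewrite Mho_Mho // (subset_trans (commgS _ (Mho_sub 1 G))) // Mho_comm.
Qed.

(** Modulo P_3, the subgroup P_1 is central, so <x> P_1 is abelian; and P_3 is
    'Mho^2(P_1). *)
Lemma powerful_cycle_Mho1 x : x \in G ->
  [~: <[x]> <*> 'Mho^1(G), <[x]> <*> 'Mho^1(G)]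
     \subset 'Mho^2(<[x]> <*> 'Mho^1(G)).
Proof.
move=> Gx; have sxG : <[x]> \subset G by rewrite cycle_subG.
have nQ : G \subset 'N('Mho^3(G)) := gFnorm _ _.
have sMG := Mho_sub 1 G.
have [nQx nQM] := (subset_trans sxG nQ, subset_trans sMG nQ).
apply: (@subset_trans _ _ ('Mho^3(G))); last first.
  by rewrite -(Mho_Mho pG powG 2 1) MhoS ?joing_subr.
have cQ (A : {set gT}) : A \subset G -> 'Mho^1(G) / 'Mho^3(G) \subset 'C(A / 'Mho^3(G)).
  move=> sAG; rewrite quotient_cents2 ?(subset_trans sAG) //.
  exact: subset_trans (commgS _ sAG) (Mho_comm pG powG 1).
rewrite -quotient_cents2 ?join_subG ?nQx // quotientY // -/(abelian _).
by rewrite abelianY quotient_abelian ?cycle_abelian // /abelian !cQ.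
Qed.

(** The hypothesis of the induction on the order of G. *)
Hypothesis IH : forall H : {group gT},
  H \proper G -> [~: H, H] \subset 'Mho^2(H) -> torsion_regular H.

(** Regularity in H = <x> P_1 applies to x^u = x [x, u], because [x, u] lies in
    P_2 = 'Mho^1(P_1) <= 'Mho^1(H). If H = G then G is cyclic, as P_1 is contained
    in the Frattini subgroup. *)
Lemma comm_torsion i x u : x \in G -> u \in G -> x ^+ (2 ^ i) = 1 ->
  [~ x, u] ^+ (2 ^ i) = 1.
Proof.
move=> Gx Gu xi; set H := (<[x]> <*> 'Mho^1(G))%G.
have sxG : <[x]> \subset G by rewrite cycle_subG.
have sHG : H \subset G by rewrite join_subG sxG Mho_sub.
have [eqHG | ltHG] := eqVproper sHG.
  have cGG : abelian G.
    have defG : 'Phi(G) <*> <[x]> = G.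
      apply/eqP; rewrite eqEsubset join_subG Phi_sub sxG /= -{1}eqHG.
      rewrite join_subG joing_subr (subset_trans _ (joing_subl _ _)) //.
      by rewrite (Phi_joing pG) joing_subr.
    by rewrite -(Phi_nongen defG) genGid cycle_abelian.
  by move/centsP/(_ x Gx u Gu)/commgP/eqP: cGG => ->; rewrite expg1n.
have Mc : [~ x, u] \in 'Mho^1(H).
  rewrite (subsetP (MhoS 1 (joing_subr _ _))) // Mho_Mho //.
  by rewrite (@mem_Mho_comm _ _ pG powG 0) ?Mho0.
have Hx : x \in H by rewrite (subsetP (joing_subl _ _)) ?cycle_id.
apply/(IH ltHG (powerful_cycle_Mho1 Gx) Hx Mc xi).
by rewrite -conjg_mulR -conjXg xi conj1g.
Qed.

(** This is regularity in P_1, since P_2 = 'Mho^1(P_1). *)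
Lemma Mho2_torsionM i x y : x \in 'Mho^2(G) -> y \in 'Mho^2(G) ->
  x ^+ (2 ^ i) = 1 -> y ^+ (2 ^ i) = 1 -> (x * y) ^+ (2 ^ i) = 1.
Proof.
move=> Mx My xi yi; case: Mho1_properVtriv => [ltMG | G1].
  apply/(IH ltMG powerful_Mho1 _ _ xi) => //; last by rewrite Mho_Mho.
  by rewrite (subsetP (Mho_leq _ (leqnSn 1))).
by move: Mx My; rewrite G1 Mho1 => /set1P-> /set1P->; rewrite mulg1 expg1n.
Qed.

(** Downward induction on s, starting where P_s = 1 and the bound follows from
    [P_k, G] <= P_(k+2) alone, and for fixed s
    induction on k. With v = u^(2^k) and f = [v, x] one has
    [v^2, x] = f^2 [f, v]^f. Here f is in P_(k+2), so f = w^(2^(k+2)), and the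
    statement for s + 1 applied to w and v bounds [f, v]: the two extra powers
    of 2 in f coming from [G, G] <= P_2 pay for the loss of one in passing from
    s to s + 1. *)
Lemma comm_exp_torsion s k u x : u \in G -> x \in G ->
    u ^+ (2 ^ s.+1) = 1 -> x ^+ (2 ^ s) = 1 ->
  [~ u ^+ (2 ^ k), x] ^+ (2 ^ (s - k)) = 1.
Proof.
have [n Mn1] := Mho_eventually1 pG powG.
have: n <= s + n by rewrite leq_addl.
elim: {2}n s k u x => [|d IHd] s k u x.
  rewrite addn0 => le_ns Gu Gx _ _; apply/set1gP; rewrite -Mn1.
  have Mc := mem_Mho_comm pG powG (mem_Mho k pG Gu) Gx.
  apply: subsetP (Mho_exp pG powG (s - k) Mc).
  apply: Mho_leq; rewrite (leq_trans le_ns) // !addSn -maxnE.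
  by rewrite !leqW // leq_maxr.
rewrite -addSnnS => le_ns Gu Gx us xs.
elim: k => [|k IHk].
  by rewrite subn0 -invg_comm expgVn comm_torsion ?invg1.
(* For k >= s the subtraction truncates, but then u^(2^(k+1)) = 1. *)
have [lt_sk | le_ks] := ltnP s k.+1.
  by rewrite (expg2_eq1_leq lt_sk us) comm1g expg1n.
set v := u ^+ (2 ^ k) in IHk *; set f := [~ v, x] in IHk *.
have Gv : v \in G by rewrite groupX.
have vs : v ^+ (2 ^ s.+1) = 1 by rewrite -expgM mulnC expgM us expg1n.
have Mf : f \in 'Mho^k.+2(G) by rewrite mem_Mho_comm ?mem_Mho.
have [w] := @Mho_root _ _ pG powG 0 k.+2 f Mf; rewrite Mho0 => Gw def_f.
have ws : w ^+ (2 ^ s.+2) = 1.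
  have -> : s.+2 = k.+2 + (s - k) by rewrite !addSn subnKC // ltnW.
  by rewrite expnD expgM -def_f.
have fv : [~ f, v] ^+ (2 ^ (s - k.+1)) = 1.
  by have:= IHd _ k.+2 w v le_ns Gw Gv ws vs; rewrite -def_f subSS.
have sM2 : 'Mho^k.+2(G) \subset 'Mho^2(G) by rewrite Mho_leq.
have Gf := subsetP (Mho_sub _ _) f Mf.
rewrite expnSr expgM -/v comm_sqrg -/f.
apply: Mho2_torsionM.
- by rewrite groupX // (subsetP sM2).
- by rewrite MhoJ_mem // (@mem_Mho_comm _ _ pG powG 0) ?Mho0.
- by rewrite -expgM -expnS -subSn // subSS.
by rewrite -conjXg fv conj1g.
Qed.

Lemma torsionM i x y : x \in G -> y \in 'Mho^1(G) ->
  x ^+ (2 ^ i) = 1 -> y ^+ (2 ^ i) = 1 -> (x * y) ^+ (2 ^ i) = 1.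
Proof.
elim: i x y => [|i IHi] x y Gx My xi yi.
  by rewrite (expg1 x : x ^+ (2 ^ 0) = x) in xi *; rewrite xi mul1g.
have Gy := subsetP (Mho_sub _ _) y My.
have [u] := @Mho_root _ _ pG powG 0 1 y My; rewrite Mho0 => Gu def_y.
have My2 : y ^+ 2 \in 'Mho^2(G) by apply: (Mho_exp pG powG 1 My).
have Myx : [~ y, x] ^ y \in 'Mho^2(G).
  by rewrite MhoJ_mem // (@mem_Mho_comm _ _ pG powG 0) ?Mho0.
have yx : [~ y, x] ^+ (2 ^ i) = 1.
  have ui : u ^+ (2 ^ i.+2) = 1 by rewrite expnS expgM -def_y.
  by have:= comm_exp_torsion 1 Gu Gx ui xi; rewrite -def_y subSS subn0.
move: xi yi; rewrite expnS !(expgM _ 2) expMg2 -mulgA => xi yi.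
apply: IHi; rewrite ?groupX //.
  by apply: subsetP (groupM My2 Myx); apply: Mho_leq.
by rewrite Mho2_torsionM // -conjXg yx conj1g.
Qed.

(** If y^(2^i) = g^(2^m), multiplying y by h = g^-(2^(m-i)) moves its 2^i-th power
    into P_(m+1); iterate until the filtration vanishes. *)
Lemma torsion_adjust i m y : i <= m -> y \in G -> y ^+ (2 ^ i) \in 'Mho^m(G) ->
  exists2 h, h \in 'Mho^(m - i)(G) & (y * h) ^+ (2 ^ i) = 1.
Proof.
have [n Mn1] := Mho_eventually1 pG powG.
have: n <= m + n by rewrite leq_addl.
elim: {2}n m y => [|d IHd] m y.
  rewrite addn0 => le_nm _ _ /(subsetP (Mho_leq _ le_nm)).
  by rewrite Mn1 => /set1gP yi; exists 1; rewrite ?group1 ?mulg1.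
rewrite -addSnnS => le_nm le_im Gy yi.
have [g] := @Mho_root _ _ pG powG 0 m _ yi; rewrite Mho0 => Gg def_yi.
set h := g^-1 ^+ (2 ^ (m - i)).
have Mh : h \in 'Mho^(m - i)(G) by rewrite mem_Mho ?groupV.
have Gh := subsetP (Mho_sub _ _) h Mh.
have [r Mr def_yh] := expMg_mod pG powG i Gy Mh.
have yhi : (y * h) ^+ (2 ^ i) \in 'Mho^m.+1(G).
  rewrite def_yh -expgM -expnD subnK // def_yi expgVn mulgV mul1g.
  by rewrite subnK in Mr.
have [h1 Mh1 yh1] := IHd _ _ le_nm (leqW le_im) (groupM Gy Gh) yhi.
exists (h * h1); last by rewrite mulgA.
by rewrite groupM // (subsetP (Mho_leq _ _) _ Mh1) // leq_sub2r.
Qed.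

Lemma torsion_regular_step : torsion_regular G.
Proof.
move=> i x y Gx My xi; split=> [xyi | ]; last exact: torsionM.
have Gy := subsetP (Mho_sub _ _) y My.
(* The 2^i-th power of y is pushed down the whole filtration: y h is in E_i, so
   x y h is too by torsionM, and comparing (x y h)^(2^i) with (x y)^(2^i) h^(2^i)
   shows that h^(2^i) is in P_(m+1). *)
have Myi m : i < m -> y ^+ (2 ^ i) \in 'Mho^m(G).
  elim: m => // m IHm; rewrite ltnS leq_eqVlt => /predU1P[<- | lt_im].
    exact: (Mho_exp pG powG i My).
  have [h Mh yhi] := torsion_adjust (ltnW lt_im) Gy (IHm lt_im).
  have Mh1 : h \in 'Mho^1(G).
    by apply: subsetP Mh; rewrite Mho_leq // subn_gt0.
  have xyhi : (x * y * h) ^+ (2 ^ i) = 1.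
    by rewrite -mulgA torsionM // groupM.
  have [r Mr] := expMg_mod pG powG i (groupM Gx Gy) Mh.
  rewrite xyhi xyi mul1g => def_r.
  have hi : h ^+ (2 ^ i) = r^-1 by apply: (mulIg r); rewrite -def_r mulVg.
  have [t Mt] := expMg_mod pG powG i Gy Mh.
  rewrite yhi hi -mulgA => def_t.
  have -> : y ^+ (2 ^ i) = (r^-1 * t)^-1.
    by apply: (mulIg (r^-1 * t)); rewrite -def_t mulVg.
  rewrite subnK ?(ltnW lt_im) // in Mr Mt.
  by rewrite groupV groupM // groupV.
have [n Mn1] := Mho_eventually1 pG powG; apply/set1gP; rewrite -Mn1.
by apply: subsetP (Myi (n + i.+1) (leq_addl _ _)); rewrite Mho_leq ?leq_addr.
Qed.

End TorsionStep.

Theorem powerful_torsion_regular gT (G : {group gT}) :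
  2.-group G -> [~: G, G] \subset 'Mho^2(G) -> torsion_regular G.
Proof.
have [n] := ubnP #|G|; elim: n G => // n IHn G leGn pG powG.
apply: torsion_regular_step => // H ltHG.
apply: IHn; last exact: pgroupS (proper_sub ltHG) pG.
exact: leq_trans (proper_card ltHG) leGn.
Qed.

(** * The exponents of the Omega subgroups *)

Section OhmBounds.

Variables (gT : finGroupType) (G : {group gT}).
Hypotheses (pG : 2.-group G) (powG : [~: G, G] \subset 'Mho^2(G)).

Lemma Mho1_Ldiv_group_set i : group_set 'Ldiv_(2 ^ i)('Mho^1(G)).
Proof.
apply/group_setP; split=> [|x y]; first by apply/LdivP; rewrite group1 expg1n.
case/LdivP=> Mx xi /LdivP[My yi]; apply/LdivP; split; first exact: groupM.
apply/(powerful_torsion_regular pG powG) => //.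
by apply: subsetP Mx; apply: Mho_sub.
Qed.

Definition Mho1_Ldiv_group i : {group gT} := Group (Mho1_Ldiv_group_set i).

Lemma Mho1_Ldiv_norm i : G \subset 'N(Mho1_Ldiv_group i).
Proof.
apply/normsP=> g Gg; rewrite /= -LdivJ; congr (_ :&: _).
by apply: (normsP (gFnorm _ _)).
Qed.

Lemma Ohm_comm_sub i : [~: 'Ohm_i(G), G] \subset Mho1_Ldiv_group i.
Proof.
have nT := Mho1_Ldiv_norm i.
have sLG : 'Ldiv_(2 ^ i)(G) \subset G := subsetIl _ _.
rewrite -quotient_cents2 ?(subset_trans (Ohm_sub i G)) //.
rewrite (OhmE i pG) quotient_gen ?(subset_trans sLG) // gen_subG.
rewrite quotient_cents2 ?(subset_trans sLG) // gen_subG.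
apply/subsetP=> _ /imset2P[x g /LdivP[Gx xi] Gg ->].
apply/LdivP; split.
  rewrite (subsetP (Mho_leq _ (leqnSn 1))) //.
  by rewrite (@mem_Mho_comm _ _ pG powG 0) ?Mho0.
apply: (comm_torsion pG powG) => // H /proper_sub sHG.
by apply: powerful_torsion_regular; apply: pgroupS pG.
Qed.

(** Modulo E_i meet P_1, the group Omega_i(G) is abelian and generated by the images
    of E_i, whose squares vanish because x^2 is in P_1 when x is in E_i. *)
Lemma Ohm_sq i x : x \in 'Ohm_i(G) -> x ^+ 2 \in Mho1_Ldiv_group i.
Proof.
have nT := Mho1_Ldiv_norm i.
have sLG : 'Ldiv_(2 ^ i)(G) \subset G := subsetIl _ _.
set T := Mho1_Ldiv_group i.
have expQ : exponent ('Ohm_i(G) / T) %| 2.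
  have cOO : abelian ('Ohm_i(G) / T).
    rewrite /abelian quotient_cents2 ?(subset_trans (Ohm_sub i G)) //.
    exact: subset_trans (commgS _ (Ohm_sub i G)) (Ohm_comm_sub i).
  move: cOO; rewrite (OhmE i pG) quotient_gen ?(subset_trans sLG) //.
  rewrite abelian_gen => /abelian_exponent_gen->.
  apply/exponentP=> _ /morphimP[y Ny /LdivP[Gy yi] ->].
  rewrite -morphX //; apply: coset_id; apply/LdivP.
  by rewrite (mem_Mho 1) // -expgM mulnC expgM yi expg1n.
move=> Ox; have Nx := subsetP nT x (subsetP (Ohm_sub i G) x Ox).
apply: coset_idr; first by rewrite groupX.
by rewrite morphX //; apply: (exponentP expQ); apply: mem_quotient.
Qed.

End OhmBounds.

Lemma powerful2E gT (G : {group gT}) :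
  2.-group G -> powerful2 G = ([~: G, G] \subset 'Mho^2(G)).
Proof. by move=> pG; rewrite /powerful2 (MhoE 2 pG). Qed.

Theorem corollary2 (gT : finGroupType) (G : {group gT})
    (pG : 2.-group G) (powG : powerful2 G) (i : nat) :
  exponent [~: 'Ohm_i(G), G] <= 2 ^ i /\ exponent 'Ohm_i(G) <= 2 ^ i.+1.
Proof.
rewrite powerful2E // in powG.
split; apply: dvdn_leq; rewrite ?expn_gt0 //; apply/exponentP=> x.
  by move/(subsetP (Ohm_comm_sub pG powG i))/LdivP=> [].
by move/(Ohm_sq pG powG)/LdivP=> [_]; rewrite -expgM -expnS.
Qed.
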